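(* There exist absolute constants $C_1,C_2>0$ such that the following holds. Let $\tilde\beta>0$, assume that $\boldsymbol{\mathscr{M}}\in\mathcal{S}_R(\tilde\beta,\tilde\alpha)$ is an $N$-way $I\times\cdots\times I$ tensor, let $\boldsymbol{\mathscr{X}}\sim\mathrm{Poisson}(\boldsymbol{\mathscr{M}})$, and let $$\widetilde{\boldsymbol{\mathscr{M}}}=\operatorname*{argmax}_{\boldsymbol{\mathscr{T}}\in\mathcal{S}_R(\tilde\beta,\tilde\alpha)}\ \sum_{\mathbf{i}}(x_{\mathbf{i}}+1)\log(t_{\mathbf{i}}+1)-(t_{\mathbf{i}}+1).$$ Then for any $\delta>0$, $$\big\|\widetilde{\boldsymbol{\mathscr{M}}}-\boldsymbol{\mathscr{M}}\big\|_F^2\le\frac{C_2(\tilde\alpha+1)^4(N+\delta)^2\log^2(I)\,N I R^2}{(\tilde\beta+1)^2}$$ with probability exceeding $1-I^{-\delta}-\exp(-C_1NI\log(N))$.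
   Context: $\circ$ denotes the vector outer product. The entries of $\boldsymbol{\mathscr{M}},\boldsymbol{\mathscr{X}},\boldsymbol{\mathscr{T}}$ at a multi-index $\mathbf{i}\in\{1,\dots,I\}^N$ are $m_{\mathbf{i}},x_{\mathbf{i}},t_{\mathbf{i}}$. The search space is $$\mathcal{S}_R(\tilde\beta,\tilde\alpha)=\Big\{\boldsymbol{\mathscr{T}}=\sum_{r=1}^R\mathbf{w}_r^{(1)}\circ\cdots\circ\mathbf{w}_r^{(N)}\ \Big|\ \mathbf{w}_r^{(n)}\in\mathbb{R}^I,\ \tilde\beta\le t_{\mathbf{i}}\le\tilde\alpha\ \text{for all }\mathbf{i}\Big\}.$$ $\boldsymbol{\mathscr{X}}\sim\mathrm{Poisson}(\boldsymbol{\mathscr{M}})$ means that the entries $x_{\mathbf{i}}$ are independent with $\mathbb{P}(x_{\mathbf{i}}=k)=m_{\mathbf{i}}^ke^{-m_{\mathbf{i}}}/k!$ for every $k\in\mathbb{N}$ (including $k=0$). $\|\cdot\|_F$ is the Frobenius norm (square root of the sum of squared entries). *)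

(* Defs.v *)
From HB Require Import structures.
From mathcomp Require Import all_boot all_order all_algebra.
From mathcomp Require Import all_classical all_reals all_analysis.

Set Implicit Arguments.
Unset Strict Implicit.
Unset Printing Implicit Defensive.

Import Order.TTheory GRing.Theory Num.Theory.

Local Open Scope classical_set_scope.
Local Open Scope ring_scope.

(* The coordinates 1, ..., I are represented by the ordinals 0, ..., I - 1. *)
Definition multi_index (N I : nat) : finType := {ffun 'I_N -> 'I_I}.

(* N-way I x ... x I arrays. *)
Definition tensor (K : Type) (N I : nat) : Type := {ffun multi_index N I -> K}.

Definition outer_product (R : realType) (N I : nat) (w : 'I_N -> 'rV[R]_I) :
    tensor R N I :=
  [ffun i : multi_index N I => \prod_(n < N) w n 0 (i n)].

Definition search_space (R : realType) (N I r : nat) (beta alpha : R) :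
    set (tensor R N I) :=
  [set T | (exists w : 'I_r -> 'I_N -> 'rV[R]_I,
              T = \sum_(s < r) outer_product (w s))
           /\ (forall i, beta <= T i <= alpha)].

Definition frobenius_norm (R : realType) (N I : nat) (T : tensor R N I) : R :=
  Num.sqrt (\sum_i T i ^+ 2).

Definition objective (R : realType) (N I : nat) (x : tensor nat N I)
    (T : tensor R N I) : R :=
  \sum_i (((x i)%:R + 1) * ln (T i + 1) - (T i + 1)).

(* A predicate rather than a function: a maximizer need not be unique, and it
   need not exist, since the tensors of bounded rank do not form a closed set. *)
Definition is_argmax (R : realType) (S : Type) (A : set S) (f : S -> R)
    (a : S) : Prop :=
  A a /\ forall b, A b -> f b <= f a.

Definition mutually_independent (R : realType) (d d' : measure_display)
    (Omega : measurableType d) (S : measurableType d')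
    (P : probability Omega R) (J : finType) (X : J -> {RV P >-> S}) : Prop :=
  forall (K : {set J}) (A : J -> set S),
    (forall j, j \in K -> measurable (A j)) ->
    P (\bigcap_(j in [set` K]) (X j @^-1` A j))
      = (\prod_(j in K) P (X j @^-1` A j))%E.

Definition poisson_tensor (R : realType) (d : measure_display)
    (Omega : measurableType d) (P : probability Omega R) (N I : nat)
    (M : tensor R N I) (X : multi_index N I -> {RV P >-> nat}) : Prop :=
  mutually_independent X /\
  forall (i : multi_index N I) (k : nat),
    P (X i @^-1` [set k]) = (M i ^+ k * expR (- M i) / k`!%:R)%:E.

Definition sample (R : realType) (d : measure_display)
    (Omega : measurableType d) (P : probability Omega R) (N I : nat)
    (X : multi_index N I -> {RV P >-> nat}) (omega : Omega) : tensor nat N I :=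
  [ffun i => X i omega].

(* Main.v *)
Require Import Defs.
From HB Require Import structures.
From mathcomp Require Import all_boot all_order all_algebra.
From mathcomp Require Import all_classical all_reals all_analysis.
From mathcomp Require Import ring lra.

(** The proof is a union bound over a finite net of the search space, with a
    Chernoff bound of exponent 1/2 at each point of the net.

    Size of the net.  The rank-one factors of a tensor of bounded entries may be
    arbitrarily large, so they cannot be discretized.  But every unfolding of a
    tensor of rank r has matrix rank at most r, hence all of its columns are
    combinations, with coefficients in [-1, 1], of at most r of its own columns:
    take the columns spanning a maximal volume and apply Cramer's rule
    ([maximal_volume_columns]).  Chaining this along the modes writes the tensor
    as a product of N matrices of size at most r with entries in [-1, 1], all of
    whose partial products are entries of the tensor itself
    ([bounded_tensor_train]).  This format is stable ([tensor_train_stable]), so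
    rounding its O(N I r^2) parameters to a grid of step 1/Z gives a net of at
    most Z^(O(N I r^2)) cells ([low_rank_quantizer]).  A logarithm of Z of order
    alpha + N^2 log I is fine enough for what follows.

    One point of the net.  Write L for the objective, M for the Poisson means.
    If T is a maximizer then L(T) >= L(M), so that exp((L(T) - L(M)) / 2) >= 1.
    For a fixed T the expectation of this variable factors over the entries, and
    each factor is at most
    exp(- (sqrt (t + 1) - sqrt (m + 1))^2 / 2), an affinity of Hellinger type,
    itself at most exp(- (t - m)^2 / (8 (alpha + 1))).  Replacing T by the
    representative of its cell, at distance at most e in each entry, costs e
    times the sum of the x_i + 2, which is absorbed in the same computation
    ([poisson_hellinger], [objective_lipschitz]).

    Altogether the probability of an error larger than B is at most the size of
    the net times exp(1 - B / (8 (alpha + 1))) ([argmax_error_tail]), and for the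
    stated B this is at most I^(-delta) ([exponent_budget]).  The term
    exp(- C1 N I log N) then makes the inequality strict; it also settles I = 1,
    where the claimed lower bound is negative. *)

Set Implicit Arguments.
Unset Strict Implicit.
Unset Printing Implicit Defensive.

Import Order.TTheory GRing.Theory Num.Theory.

Local Open Scope classical_set_scope.
Local Open Scope ring_scope.

(** * Bounded column interpolation of low-rank matrices *)

(** Among all choices of columns of a full-rank row factor Q of A, the one of
    largest absolute determinant expresses every other column with coefficients
    at most 1: replacing a chosen column by another one cannot increase the
    volume, and the coefficient is the ratio of the two volumes. *)
Lemma maximal_volume_columns (F : realFieldType) (m n : nat) (A : 'M[F]_(m, n)) :
  exists (J : 'I_(\rank A) -> 'I_n) (C : 'M[F]_(\rank A, n)),
    (forall k j, `|C k j| <= 1) /\ A = colsub J A *m C.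
Proof.
pose Q := row_base A.
have Qfull : row_full Q^T.
  by have := row_base_free A; rewrite /row_free /row_full mxrank_tr.
pose J0 := finfun (fullrankfun Qfull).
have J0unit : \det (colsub J0 Q) != 0.
  rewrite -det_tr -unitfE -unitmxE.
  suff -> : (colsub J0 Q)^T = rowsub (fullrankfun Qfull) Q^T.
    exact: fullrowsub_unit.
  by apply/matrixP => i j; rewrite !mxE ffunE.
pose vol (J : {ffun 'I_(\rank A) -> 'I_n}) := `|\det (colsub J Q)|.
have [J _ Jmax] := @arg_maxP _ _ _ J0 xpredT vol isT.
have Jpos : 0 < vol J by apply: lt_le_trans (Jmax J0 isT); rewrite normr_gt0.
have Junit : colsub J Q \in unitmx by rewrite unitmxE unitfE -normr_gt0.
exists J, (invmx (colsub J Q) *m Q); split => [k j|].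
  (* Cramer's rule: a coefficient is a quotient of two volumes. *)
  rewrite /invmx Junit -scalemxAl mxE.
  pose J' := [ffun l => if l == k then j else J l].
  have -> : (\adj (colsub J Q) *m Q) k j = \det (colsub J' Q).
    rewrite (expand_det_col _ k) mxE; apply: eq_bigr => l _.
    rewrite !mxE ffunE eqxx mulrC; congr (_ * _).
    rewrite /cofactor; congr (_ * \det _); apply/matrixP => a b.
    by rewrite !mxE ffunE eq_sym (negPf (neq_lift _ _)).
  by rewrite normrM normfV mulrC ler_pdivrMr // mul1r; apply: Jmax.
have -> : colsub J A = col_base A *m colsub J Q.
  by rewrite mulmx_colsub mulmx_base.
by rewrite -mulmxA (mulmxA (colsub J Q)) mulmxV // mul1mx mulmx_base.
Qed.

(** The number of interpolation columns is made independent of the actual rank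
    by padding with columns of coefficient 0.  Bounding it by the number of
    columns as well as by r keeps the logarithm of the stability constant of the
    tensor train independent of r. *)
Lemma bounded_interpolation (F : realFieldType) (U V : finType) (r : nat)
    (f : U -> V -> F) (p : U -> 'I_r -> F) (q : 'I_r -> V -> F) :
  (forall u v, f u v = \sum_s p u s * q s v) ->
  exists (J : 'I_(minn r #|V|) -> V) (c : V -> 'I_(minn r #|V|) -> F),
    (forall v k, `|c v k| <= 1) /\
    (forall u v, f u v = \sum_k c v k * f u (J k)).
Proof.
move=> fE; set rho := minn r #|V|.
pose A : 'M[F]_(#|U|, #|V|) := \matrix_(i, j) f (enum_val i) (enum_val j).
have le_rank : (\rank A <= rho)%N.
  rewrite leq_min rank_leq_col andbT.
  pose p' : 'M[F]_(#|U|, r) := \matrix_(i, s) p (enum_val i) s.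
  pose q' : 'M[F]_(r, #|V|) := \matrix_(s, j) q s (enum_val j).
  have -> : A = p' *m q'.
    by apply/matrixP => i j; rewrite !mxE fE; apply: eq_bigr => s _; rewrite !mxE.
  by rewrite (leq_trans (mxrankM_maxl _ _)) // rank_leq_col.
have [J [C [Cle AE]]] := maximal_volume_columns A.
have le_rhoV : (rho <= #|V|)%N by apply: geq_minr.
pose J' (k : 'I_rho) : V :=
  if insub (k : nat) is Some k' then enum_val (J k')
  else enum_val (widen_ord le_rhoV k).
pose c (v : V) (k : 'I_rho) : F :=
  if insub (k : nat) is Some k' then C k' (enum_rank v) else 0.
exists J', c; split => [v k|u v].
  by rewrite /c; case: insubP => [k' _ _ //|_]; rewrite normr0 ler01.
have := congr1 (fun B : 'M[F]_(#|U|, #|V|) => B (enum_rank u) (enum_rank v)) AE.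
rewrite !mxE !enum_rankK => ->.
pose G (k : nat) := if insub k is Some k' then
  C k' (enum_rank v) * f u (enum_val (J k')) else 0.
rewrite (eq_bigr (fun k : 'I_(\rank A) => G k)); last first.
  by move=> k _; rewrite /G valK !mxE enum_rankK mulrC.
rewrite (big_ord_widen _ G le_rank) big_mkcond; apply: eq_bigr => k _.
rewrite /G /c /J'; case: insubP => [k' -> _|/negPf ->] //.
by rewrite mul0r.
Qed.

(** * Tensor trains with bounded cores *)

(** Unfoldings are indexed by pairs of full multi-indices, of which only the
    first n coordinates of i and the last ones of j matter; this avoids separate
    types for prefixes and suffixes. *)
Definition splice (N I n : nat) (i j : multi_index N I) : multi_index N I :=
  [ffun k : 'I_N => if (k < n)%N then i k else j k].

Lemma low_rank_unfolding (R : realType) (N I r n : nat)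
    (w : 'I_r -> 'I_N -> 'rV[R]_I) (i j : multi_index N I) :
  (\sum_(s < r) outer_product (w s)) (splice n i j) =
  \sum_(s < r) (\prod_(k < N | (k < n)%N) w s k 0 (i k)) *
               (\prod_(k < N | ~~ (k < n)%N) w s k 0 (j k)).
Proof.
rewrite sum_ffunE; apply: eq_bigr => s _.
rewrite ffunE (bigID (fun k : 'I_N => (k < n)%N)) /=.
by congr (_ * _); apply: eq_bigr => k; rewrite ffunE; [move=> -> | move=> /negPf ->].
Qed.

(** The nth state v n i lists the entries of T whose first n coordinates are
    those of i and whose remaining ones come from the interpolation columns of
    the nth unfolding.  Passing to n + 1 frees one coordinate: an interpolation
    column of unfolding n + 1, once coordinate n is fixed, is a column of
    unfolding n, so it is interpolated there with coefficients in [-1, 1].  As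
    the states consist of entries of T, they inherit its bound a whatever the
    number of factors already multiplied. *)
Lemma bounded_tensor_train (R : realType) (N I r : nat) (T : tensor R N I)
    (w : 'I_r -> 'I_N -> 'rV[R]_I) (a : R) :
  T = \sum_(s < r) outer_product (w s) -> (forall i, `|T i| <= a) ->
  exists (G : 'I_N -> 'I_I -> 'I_(minn r (I ^ N)) -> 'I_(minn r (I ^ N)) -> R)
         (v : nat -> multi_index N I -> 'I_(minn r (I ^ N)) -> R),
    [/\ forall n b k l, `|G n b k l| <= 1,
        forall n i k, `|v n i k| <= a,
        forall i j, v 0%N i = v 0%N j,
        forall (n : 'I_N) i k, v n.+1 i k = \sum_l G n (i n) k l * v n i l &
        forall i k, v N i k = T i].
Proof.
move=> TE Ta.
have card_mi : (I ^ N)%N = #|multi_index N I| by rewrite card_ffun !card_ord.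
rewrite card_mi; set rho := minn _ _.
have interp n : exists Jc : ('I_rho -> multi_index N I) *
    (multi_index N I -> 'I_rho -> R),
    (forall j k, `|Jc.2 j k| <= 1) /\
    (forall i j, T (splice n i j) = \sum_k Jc.2 j k * T (splice n i (Jc.1 k))).
  have TnE i j : T (splice n i j) = _ := etrans
    (congr1 (fun T' : tensor R N I => T' (splice n i j)) TE)
    (low_rank_unfolding n w i j).
  have [J [c H]] := bounded_interpolation TnE.
  by exists (J, c).
have [Jc Jc_spec] := choice interp.
pose move_to (n : 'I_N) b (j : multi_index N I) : multi_index N I :=
  [ffun k => if k == n then b else j k].
exists (fun (n : 'I_N) b k l => (Jc n).2 (move_to n b ((Jc n.+1).1 k)) l).
exists (fun n i k => T (splice n i ((Jc n).1 k))); split.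
- by move=> n b k l; have [+ _] := Jc_spec n; apply.
- by move=> n i k; apply: Ta.
- by move=> i j; apply/funext => k; congr (T _); apply/ffunP => l; rewrite !ffunE.
- move=> n i k; have [_ <-] := Jc_spec n; congr (T _); apply/ffunP => l.
  rewrite !ffunE ltnS leq_eqVlt -val_eqE /=.
  by case: eqP => //= /val_inj ->; rewrite ltnn.
- by move=> i k; congr (T _); apply/ffunP => l; rewrite !ffunE ltn_ord.
Qed.

(** * Quantization of the search space *)

Definition digit (R : realType) (Z : R) (x : R) :
  'I_(Num.truncn (2 * Z)).+1 := inord (Num.truncn ((x + 1) * Z)).

Lemma digit_eq (R : realType) (Z x y : R) : 0 < Z -> `|x| <= 1 -> `|y| <= 1 ->
  digit Z x = digit Z y -> `|x - y| <= Z^-1.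
Proof.
move=> Z0; rewrite !ler_norml => /andP[x0 x1] /andP[y0 y1] /(congr1 val).
have aux z : -1 <= z -> z <= 1 ->
    (Num.truncn ((z + 1) * Z) < (Num.truncn (2 * Z)).+1)%N.
  move=> z0 z1; rewrite ltnS; apply: le_truncn.
  by rewrite ler_pM2r //; lra.
rewrite /= !inordK ?aux // => xy.
have xZ : 0 <= (x + 1) * Z by rewrite mulr_ge0 ?(ltW Z0) //; lra.
have yZ : 0 <= (y + 1) * Z by rewrite mulr_ge0 ?(ltW Z0) //; lra.
have /andP[lx ux] := truncn_itv xZ; have /andP[ly uy] := truncn_itv yZ.
rewrite -xy in ly uy; rewrite -natr1 in ux uy.
rewrite -[Z^-1]mul1r -ler_norml ler_pdivlMr // -[Z in _ * Z]gtr0_norm //.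
rewrite -normrM ler_norml; set t := (Num.truncn _)%:R in lx ux ly uy.
have -> : (x - y) * Z = (x + 1) * Z - (y + 1) * Z by ring.
by apply/andP; split; lra.
Qed.

(** Each core contracts rho terms of size at most e + a / Z, where e >= a / Z is
    the error of the previous state; hence a factor 2 rho per mode.  The bound a on
    the states is what keeps the perturbation of a core from being amplified by
    the product of the earlier ones. *)
Lemma tensor_train_stable (R : realType) (N I rho : nat) (Z a : R)
    (G G' : 'I_N -> 'I_I -> 'I_rho -> 'I_rho -> R)
    (v v' : nat -> multi_index N I -> 'I_rho -> R) :
  0 < Z -> (0 < rho)%N -> 0 <= a ->
  (forall n b k l, `|G n b k l| <= 1) ->
  (forall n b k l, `|G n b k l - G' n b k l| <= Z^-1) ->
  (forall n i k, `|v' n i k| <= a) ->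
  (forall i k, `|v 0%N i k - v' 0%N i k| <= a / Z) ->
  (forall (n : 'I_N) i k, v n.+1 i k = \sum_l G n (i n) k l * v n i l) ->
  (forall (n : 'I_N) i k, v' n.+1 i k = \sum_l G' n (i n) k l * v' n i l) ->
  forall n i k, (n <= N)%N ->
    `|v n i k - v' n i k| <= (2 * rho%:R) ^+ n * (a / Z).
Proof.
move=> Z0 rho0 a0 G1 GG' v'a vv'0 vS v'S.
elim=> [|n IHn] i k nN; first by rewrite expr0 mul1r.
have -> : n = Ordinal nN by [].
rewrite vS v'S -sumrB; apply: le_trans (ler_norm_sum _ _ _) _.
set e := (2 * rho%:R) ^+ n * (a / Z).
have aZ : 0 <= a / Z by rewrite divr_ge0 // ltW.
have rho1 : 1 <= 2 * rho%:R :> R.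
  by rewrite -natrM ler1n muln_gt0.
have aZe : a / Z <= e by rewrite /e ler_peMl // exprn_ege1.
have -> : (2 * rho%:R) ^+ (Ordinal nN).+1 * (a / Z) = \sum_(l < rho) (2 * e).
  by rewrite sumr_const card_ord /e exprS -mulr_natl; ring.
apply: ler_sum => l _ /=.
set g := G _ _ _ _; set g' := G' _ _ _ _; set x := v _ _ _; set x' := v' _ _ _.
have -> : g * x - g' * x' = g * (x - x') + (g - g') * x' by ring.
apply: le_trans (ler_normD _ _) _; rewrite !normrM mulrDl mul1r lerD //.
  rewrite -[e]mul1r ler_pM //; first exact: G1.
  exact: IHn (ltnW nN).
by apply: le_trans aZe; rewrite mulrC ler_pM //; [exact: v'a|exact: GG'].
Qed.

(** The code of a tensor consists of the rounded cores of one of its trains and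
    of its rounded initial state, divided by alpha to lie in [-1, 1].  A code
    map, rather than a list of centres, lets any subset of the search space pick
    its representatives inside itself. *)
Lemma low_rank_quantizer (R : realType) (N I r : nat) (beta alpha Z : R) :
  let rho := minn r (I ^ N) in
  let b := (Num.truncn (2 * Z)).+1 in
  (0 < r)%N -> (0 < I)%N -> 0 < beta -> beta <= alpha -> 0 < Z ->
  exists (F : finType) (q : tensor R N I -> F),
    #|F| = (b ^ (N * I * rho * rho + rho))%N /\
    forall T T', search_space r beta alpha T -> search_space r beta alpha T' ->
      q T = q T' -> forall i, `|T i - T' i| <= (2 * rho%:R) ^+ N * (alpha / Z).
Proof.
move=> rho b r0 I0 beta0 beta_alpha Z0.
have alpha0 : 0 < alpha by apply: lt_le_trans beta_alpha.
have rho0 : (0 < rho)%N by rewrite leq_min r0 expn_gt0 I0.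
pose train T (Gv : ('I_N -> 'I_I -> 'I_rho -> 'I_rho -> R) *
    (nat -> multi_index N I -> 'I_rho -> R)) :=
    [/\ forall n b k l, `|Gv.1 n b k l| <= 1,
        forall n i k, `|Gv.2 n i k| <= alpha,
        forall i j, Gv.2 0%N i = Gv.2 0%N j,
        forall (n : 'I_N) i k,
          Gv.2 n.+1 i k = \sum_l Gv.1 n (i n) k l * Gv.2 n i l &
        forall i k, Gv.2 N i k = T i].
have train_ex T : exists Gv, search_space r beta alpha T -> train T Gv.
  have [[[w TE] Tb]|nT] := pselect (search_space r beta alpha T); last first.
    by exists (fun _ _ _ _ => 0, fun _ _ _ => 0).
  have Ta i : `|T i| <= alpha.
    by have /andP[h1 h2] := Tb i; rewrite ger0_norm // (le_trans (ltW beta0)).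
  by have [G [v H]] := bounded_tensor_train TE Ta; exists (G, v).
have [Gv GvP] := choice train_ex.
pose i0 : multi_index N I := [ffun=> Ordinal I0].
pose F : finType := ({ffun 'I_N * 'I_I * 'I_rho * 'I_rho -> 'I_b} *
                     {ffun 'I_rho -> 'I_b})%type.
(* The initial state does not depend on the multi-index, so i0 is arbitrary. *)
pose q T : F := ([ffun t => digit Z ((Gv T).1 t.1.1.1 t.1.1.2 t.1.2 t.2)],
                 [ffun k => digit Z ((Gv T).2 0%N i0 k / alpha)]).
exists F, q; split.
  by rewrite card_prod !card_ffun !card_prod !card_ord -expnD.
move=> T T' ST ST' [/ffunP qG /ffunP qv] i.
have [G1 va v0 vS vN] := GvP _ ST; have [G'1 v'a v'0 v'S v'N] := GvP _ ST'.
pose k0 := Ordinal rho0; rewrite -(vN i k0) -(v'N i k0).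
apply: (tensor_train_stable Z0 rho0 (ltW alpha0) G1 _ v'a _ vS v'S) => //.
- move=> n c k l; have := qG (n, c, k, l); rewrite !ffunE /=.
  by apply: digit_eq.
- move=> j k; rewrite (v0 j i0) (v'0 j i0).
  have := qv k; rewrite !ffunE => /digit_eq.
  have unit_range x : `|x| <= alpha -> `|x / alpha| <= 1.
    by move=> xa; rewrite normrM normfV (gtr0_norm alpha0) ler_pdivrMr // mul1r.
  move=> /(_ Z0 (unit_range _ (va _ _ _)) (unit_range _ (v'a _ _ _))).
  by rewrite -mulrBl normrM normfV (gtr0_norm alpha0) ler_pdivrMr // mulrC.
Qed.

(** * Markov's inequality for independent counts *)

Lemma measurable_discrete_sample (R : realType) (d : measure_display)
    (Omega : measurableType d) (P : probability Omega R) (J : finType)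
    (X : J -> {RV P >-> nat}) (A : set {ffun J -> nat}) :
  measurable [set omega | A [ffun j => X j omega]].
Proof.
have -> : [set omega | A [ffun j => X j omega]] =
    \bigcup_(x : {ffun J -> nat})
      (if `[< A x >] then \bigcap_(j in [set: J]) (X j @^-1` [set x j]) else set0).
  apply/seteqP; split => [omega /= Ax|omega [x _]].
    by exists [ffun j => X j omega] => //; rewrite asboolT // => j _; rewrite /= ffunE.
  case: asboolP => //= Ax xE; have -> // : [ffun j => X j omega] = x.
  by apply/ffunP => j; rewrite ffunE; exact: xE.
apply: countable_bigcupT_measurable => // x; case: asboolP => // _.
apply: fin_bigcap_measurable; first exact: finite_finset.
by move=> j _; rewrite -[X in measurable X]setTI; exact: measurable_funPT.
Qed.

(** Markov's inequality for the variable sum_c prod_j g c j (X j), whose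
    expectation factors by independence.  Working on the event that all X j are
    below K turns the expectation into a finite sum, where exchanging sum and
    product is distributivity; letting K grow recovers the whole event by
    continuity of the measure, so that no integral is involved. *)
Lemma markov_mutually_independent (R : realType) (d : measure_display)
    (Omega : measurableType d) (P : probability Omega R) (J : finType)
    (X : J -> {RV P >-> nat}) (p : J -> nat -> R) (A : set {ffun J -> nat})
    (C : finType) (g : C -> J -> nat -> R) (B : R) :
  mutually_independent X ->
  (forall j k, P (X j @^-1` [set k]) = (p j k)%:E) ->
  (forall c j k, 0 <= g c j k) ->
  (forall x, A x -> 1 <= \sum_c \prod_j g c j (x j)) ->
  (forall K, \sum_c \prod_j \sum_(k < K) p j k * g c j k <= B) ->
  (P [set omega | A [ffun j => X j omega]] <= B%:E)%E.
Proof.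
move=> Xind Xlaw g0 A1 AB; set E := [set omega | _].
pose below K (x : {ffun J -> nat}) := forall j, (x j < K)%N.
pose trunc K := [set omega | (A `&` [set x | below K x]) [ffun j => X j omega]].
have mE : measurable E by exact: measurable_discrete_sample.
have mtrunc K : measurable (trunc K) by exact: measurable_discrete_sample.
have p0 j k : 0 <= p j k by rewrite -lee_fin -Xlaw.
have truncE : \bigcup_K trunc K = E.
  apply/seteqP; split => [omega [K _ []//]|omega AX].
  exists (\max_j X j omega).+1 => //; split => // j.
  by rewrite ffunE ltnS; exact: (leq_bigmax j).
have trunc_cvg : P (trunc K) @[K --> \oo] --> P E.
  rewrite -truncE; apply: (@nondecreasing_cvg_mu _ _ _ P) => //.
    by rewrite truncE.
  move=> K L KL; apply/subsetPset => omega [AX XK]; split => // j.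
  exact: leq_trans (XK j) KL.
apply: (cvge_le _ trunc_cvg); apply: nearW => K.
pose emb (y : {ffun J -> 'I_K}) : {ffun J -> nat} := [ffun j => y j : nat].
pose cell y := if `[< A (emb y) >]
  then [set omega | [ffun j => X j omega] = emb y] else set0.
have mcell y : measurable (cell y).
  by rewrite /cell; case: asboolP => // _; exact: (measurable_discrete_sample X [set emb y]).
have cover : trunc K `<=` \bigcup_(y in [set` index_enum {ffun J -> 'I_K}]) cell y.
  move=> omega [AX XK]; exists [ffun j => Ordinal (XK j)]; first exact: mem_index_enum.
  have embE : [ffun j => X j omega] = emb [ffun j => Ordinal (XK j)].
    by apply/ffunP => j; rewrite !ffunE /= ffunE.
  by rewrite /cell asboolT //= -embE.
have Pcell y : (P (cell y) <=
    (\sum_c \prod_j (p j (y j) * g c j (y j)))%:E)%E.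
  rewrite /cell; case: asboolP => [Ay|_]; last first.
    by rewrite measure0 lee_fin sumr_ge0 // => c _; rewrite prodr_ge0 // => j _; rewrite mulr_ge0.
  have -> : [set omega | [ffun j => X j omega] = emb y] =
      \bigcap_(j in [set` [set: J]%SET]) (X j @^-1` [set (y j : nat)]).
    apply/seteqP; split => [omega /= /ffunP XE j _|omega XE].
      by have := XE j; rewrite !ffunE.
    by apply/ffunP => j; rewrite !ffunE; apply: XE; rewrite /= inE.
  rewrite (Xind _ (fun j => [set (y j : nat)])) //.
  rewrite (eq_bigr (fun j => (p j (y j))%:E)); last by move=> j _; exact: Xlaw.
  rewrite prodEFin lee_fin (eq_bigl xpredT); last by move=> j; rewrite inE.
  under [leRHS]eq_bigr do rewrite big_split /=.
  rewrite -mulr_sumr ler_peMr ?prodr_ge0 //.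
  have := A1 _ Ay; congr (_ <= _); apply: eq_bigr => c _.
  by apply: eq_bigr => j _; rewrite ffunE.
have /le_trans := content_sub_fsum P (finite_seq _)
  (fun y _ => mcell y) (mtrunc K) cover; apply.
rewrite -fsbig_seq ?index_enum_uniq //.
apply: (le_trans (lee_sum _ (fun y _ => Pcell y))).
rewrite sumEFin lee_fin exchange_big /=; apply: le_trans (AB K).
by apply: ler_sum => c _; rewrite bigA_distr_bigA.
Qed.

(** * The Poisson likelihood *)

Lemma exp_partial_sum_le (R : realType) (x : R) (K : nat) :
  0 <= x -> \sum_(k < K) x ^+ k / k`!%:R <= expR x.
Proof.
move=> x0; rewrite -(big_mkord xpredT (fun k => x ^+ k / k`!%:R)).
apply: (nondecreasing_cvgn_le _ (is_cvg_series_exp_coeff x)).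
apply: nondecreasing_series => k _ _; exact: exp_coeff_ge0.
Qed.

Lemma poisson_pgf_le (R : realType) (m z : R) (K : nat) : 0 <= m -> 0 <= z ->
  \sum_(k < K) (m ^+ k * expR (- m) / k`!%:R) * z ^+ k <= expR (m * (z - 1)).
Proof.
move=> m0 z0.
rewrite (eq_bigr (fun k : 'I_K => expR (- m) * ((m * z) ^+ k / k`!%:R))); last first.
  by move=> k _; rewrite exprMn; ring.
rewrite -mulr_sumr mulrBr mulr1 expRD mulrC ler_wpM2r ?expR_ge0 //.
by rewrite exp_partial_sum_le // mulr_ge0.
Qed.

Lemma expR_half_le (R : realType) (e : R) : 0 <= e -> e <= 1 ->
  expR (e / 2) <= 1 + e.
Proof.
move=> e0 e1; have := expR_ge1Dx (- (e / 2)).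
rewrite expRN => h; have E0 := expR_gt0 (e / 2).
move: h; rewrite -(ler_pM2r E0) mulVf ?gt_eqF // => h.
have : (1 - e / 2) * (1 + e) >= 1 by nra.
move=> h2; rewrite -(@ler_pM2l _ (1 - e / 2)); last by lra.
by apply: le_trans h2.
Qed.

Lemma sqrt_gap (R : realType) (a b alpha : R) :
  a ^+ 2 <= alpha -> b ^+ 2 <= alpha -> 0 < alpha ->
  (a ^+ 2 - b ^+ 2) ^+ 2 / (8 * alpha) <= (a - b) ^+ 2 / 2.
Proof.
move=> a1 b1 alpha0; rewrite ler_pdivrMr; last by lra.
have -> : (a - b) ^+ 2 / 2 * (8 * alpha) = (a - b) ^+ 2 * (4 * alpha) by field.
have -> : (a ^+ 2 - b ^+ 2) ^+ 2 = (a - b) ^+ 2 * (a + b) ^+ 2 by ring.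
rewrite ler_wpM2l ?sqr_ge0 //; have := sqr_ge0 (a - b); nra.
Qed.

(** The score of one entry is an affine function of k, so the sum is a truncated
    generating function at z = u exp(e / 2), with u = sqrt ((t + 1) / (m + 1)).
    For e = 0 the exponent is ln u - (t - m) / 2 + m (u - 1); bounding ln u by
    u - 1 turns the factor m into m + 1, which matches the shift by 1 in the
    objective and leaves - (sqrt (t + 1) - sqrt (m + 1))^2 / 2. *)
Lemma poisson_hellinger (R : realType) (m t alpha e : R) (K : nat) :
  0 <= m -> m <= alpha -> 0 <= t -> t <= alpha -> 0 <= e -> e <= 1 ->
  \sum_(k < K) (m ^+ k * expR (- m) / k`!%:R) *
    expR (((k%:R + 1) * (ln (t + 1) - ln (m + 1)) - (t - m) + e * (k%:R + 2)) / 2)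
  <= expR (e * (alpha + 2) - (t - m) ^+ 2 / (8 * (alpha + 1))).
Proof.
move=> m0 malpha t0 talpha e0 e1.
have sqrt_ex y : 0 <= y -> exists2 x : R, 0 < x & x ^+ 2 = y + 1.
  move=> y0; exists (Num.sqrt (y + 1)); first by rewrite sqrtr_gt0; lra.
  by rewrite sqr_sqrtr //; lra.
have [a a0 a2] := sqrt_ex t t0; have [b b0 b2] := sqrt_ex m m0.
pose u := a / b; have u0 : 0 < u by rewrite divr_gt0.
have lnE : ln (t + 1) - ln (m + 1) = 2 * ln u.
  have -> : ln u = ln a - ln b by apply: ln_div; rewrite posrE.
  by rewrite -a2 -b2 (lnXn 2 a0) (lnXn 2 b0) !mulr2n; ring.
pose z := u * expR (e / 2).
have z0 : 0 <= z by rewrite mulr_ge0 ?expR_ge0 // ltW.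
pose c := ln u - (t - m) / 2 + e.
rewrite (eq_bigr (fun k : 'I_K =>
    expR c * ((m ^+ k * expR (- m) / k`!%:R) * z ^+ k))); last first.
  move=> k _; rewrite mulrCA; congr (_ * _).
  rewrite /z -{1}(lnK u0) -expRD -expRM_natl -expRD lnE; congr expR.
  by rewrite /c; field.
rewrite -mulr_sumr.
apply: (le_trans (ler_wpM2l (expR_ge0 _) (poisson_pgf_le K m0 z0))).
rewrite -expRD ler_expR.
have lnu : ln u <= u - 1 by have := @le_ln1Dx R (u - 1); rewrite subrKC; apply; lra.
have zu : z <= u * (1 + e) by rewrite ler_pM2l // expR_half_le.
have ub : b ^+ 2 * u = a * b by rewrite /u; field; rewrite gt_eqF.
have mz : m * z <= m * (u * (1 + e)) by rewrite ler_wpM2l.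
have mu : m * u <= alpha + 1.
  have : m * u <= a * b by rewrite -ub ler_pM2r // b2; lra.
  by have := sqr_ge0 (a - b); nra.
have gap : (t - m) ^+ 2 / (8 * (alpha + 1)) <= (a - b) ^+ 2 / 2.
  have -> : t - m = a ^+ 2 - b ^+ 2 by rewrite a2 b2; ring.
  by apply: sqrt_gap; rewrite ?a2 ?b2; lra.
have mue : e * (m * u) <= e * (alpha + 1) by rewrite ler_wpM2l.
have main : (u - 1) - (t - m) / 2 + m * (u - 1) = - ((a - b) ^+ 2 / 2).
  have -> : t - m = a ^+ 2 - b ^+ 2 by rewrite a2 b2; ring.
  have -> : m = b ^+ 2 - 1 by rewrite b2; ring.
  have -> : (u - 1) - (a ^+ 2 - b ^+ 2) / 2 + (b ^+ 2 - 1) * (u - 1) =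
    b ^+ 2 * u - b ^+ 2 - (a ^+ 2 - b ^+ 2) / 2 by ring.
  by rewrite ub; field.
rewrite /c; lra.
Qed.

(** The shift by 1 in the objective makes t -> ln (t + 1) 1-Lipschitz on
    nonnegative arguments, whatever the lower bound on the entries. *)
Lemma objective_lipschitz (R : realType) (N I : nat) (x : tensor nat N I)
    (T T' : tensor R N I) (e : R) :
  (forall i, 0 <= T i) -> (forall i, 0 <= T' i) ->
  (forall i, `|T i - T' i| <= e) ->
  objective x T <= objective x T' + \sum_i e * ((x i)%:R + 2).
Proof.
move=> T0 T'0 TT'; rewrite /objective -big_split; apply: ler_sum => i _ /=.
have := TT' i; rewrite ler_norml => /andP[lo hi].
have h0 := T0 i; have h'0 := T'0 i.
have e0 : 0 <= e by apply: le_trans (TT' i).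
have lnT : ln (T i + 1) <= ln (T' i + 1) + e.
  have pos : 0 < (T i + 1) / (T' i + 1) by rewrite divr_gt0; lra.
  have -> : T i + 1 = (T' i + 1) * ((T i + 1) / (T' i + 1)).
    by rewrite mulrC divfK // gt_eqF //; lra.
  rewrite lnM ?posrE //; [rewrite lerD2l | by lra].
  have := @le_ln1Dx R ((T i + 1) / (T' i + 1) - 1); rewrite subrKC => h.
  apply: le_trans (h _) _; first by lra.
  rewrite lerBlDr ler_pdivrMr; [nra | by lra].
have x0 : 0 <= (x i)%:R :> R by [].
have : ((x i)%:R + 1) * ln (T i + 1) <= ((x i)%:R + 1) * (ln (T' i + 1) + e).
  by rewrite ler_wpM2l //; lra.
lra.
Qed.

Lemma frobenius_normE (R : realType) (N I : nat) (T : tensor R N I) :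
  frobenius_norm T ^+ 2 = \sum_i T i ^+ 2.
Proof. by rewrite sqr_sqrtr // sumr_ge0 // => i _; rewrite sqr_ge0. Qed.

(** The net consists of one representative per cell that meets the set of far
    tensors (error above B), so the representatives are themselves far and the
    Hellinger bound applies to each of them with the full gain B. *)
Lemma argmax_error_tail (R : realType) (N I r : nat) (beta alpha e B : R)
    (M : tensor R N I) (d : measure_display) (Omega : measurableType d)
    (P : probability Omega R) (X : multi_index N I -> {RV P >-> nat})
    (F : finType) (q : tensor R N I -> F) :
  0 < beta -> search_space r beta alpha M -> poisson_tensor M X ->
  0 <= e -> e <= 1 ->
  (forall T T', search_space r beta alpha T -> search_space r beta alpha T' ->
     q T = q T' -> forall i, `|T i - T' i| <= e) ->
  0 < alpha ->
  (P [set omega | exists2 T, is_argmax (search_space r beta alpha)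
        (objective (sample X omega)) T & (B < frobenius_norm (T - M) ^+ 2)%R]
   <= (#|F|%:R * expR ((I ^ N)%:R * (e * (alpha + 2)) - B / (8 * (alpha + 1))))%:E)%E.
Proof.
move=> beta0 SM [Xind Xlaw] e0 e1 qe alpha0.
pose far T := search_space r beta alpha T /\ B < frobenius_norm (T - M) ^+ 2.
pose C : finType := {c : F | `[< exists T, far T /\ q T = c >]}.
pose rep (c : C) := sval (cid (asboolW (valP c))).
have repP c : far (rep c) /\ q (rep c) = val c by exact: svalP (cid (asboolW (valP c))).
have entry0 (T : tensor R N I) i : search_space r beta alpha T -> 0 <= T i.
  by case=> _ /(_ i) /andP[h _]; apply: le_trans h; apply: ltW.
have entry1 (T : tensor R N I) i : search_space r beta alpha T -> T i <= alpha.
  by case=> _ /(_ i) /andP[_ h].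
pose g (c : C) i (k : nat) : R := expR (((k%:R + 1) *
  (ln (rep c i + 1) - ln (M i + 1)) - (rep c i - M i) + e * (k%:R + 2)) / 2).
apply: (@markov_mutually_independent R d Omega P _ X
  (fun i k => M i ^+ k * expR (- M i) / k`!%:R)
  [set x | exists2 T, is_argmax (search_space r beta alpha) (objective x) T
                    & B < frobenius_norm (T - M) ^+ 2] C g _ Xind Xlaw).
- by move=> c i k; exact: expR_ge0.
- move=> x [T [ST Tmax] TB].
  have hc : `[< exists T', far T' /\ q T' = q T >] by apply/asboolP; exists T.
  pose c : C := exist _ (q T) hc.
  have [[Src _] qrc] := repP c.
  (* The maximizer T beats M, and the slack e (x i + 2) pays for the move from
     T to the representative of its cell. *)
  have gc : 1 <= \prod_i g c i (x i).
    rewrite -expR_sum -[leLHS]expR0 ler_expR -mulr_suml.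
    rewrite pmulr_lge0 ?invr_gt0 //.
    have LT := Tmax _ SM.
    have := @objective_lipschitz R N I x T (rep c) e
      (fun i => entry0 T i ST) (fun i => entry0 _ i Src)
      (qe _ _ ST Src (esym qrc)).
    move=> /(le_trans LT); rewrite -subr_ge0 => h; apply: le_trans h _.
    rewrite /objective -big_split -sumrB /=; apply: ler_sum => i _.
    rewrite le_eqVlt; apply/orP; left; apply/eqP; ring.
  apply: le_trans gc _; rewrite (bigD1 c) //= lerDl sumr_ge0 // => c' _.
  by apply: prodr_ge0 => i _; exact: expR_ge0.
- move=> K; set E := expR _.
  have bound c : \prod_i \sum_(k < K) (M i ^+ k * expR (- M i) / k`!%:R) * g c i k <= E.
    have [[Src Bc] _] := repP c.
    apply: (@le_trans _ _ (\prod_i expR (e * (alpha + 2) -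
        (rep c i - M i) ^+ 2 / (8 * (alpha + 1))))).
      apply: ler_prod => i _; apply/andP; split.
        apply: sumr_ge0 => k _; rewrite mulr_ge0 ?expR_ge0 // divr_ge0 //.
        by rewrite mulr_ge0 ?expR_ge0 // exprn_ge0 // entry0.
      by apply: poisson_hellinger; rewrite ?entry0 ?entry1.
    rewrite -expR_sum ler_expR sumrB sumr_const -mulr_suml.
    rewrite card_ffun !card_ord -[X in X - _ <= _]mulr_natl lerD2l lerN2 ler_wpM2r //.
      by rewrite invr_ge0; lra.
    apply: ltW; apply: lt_le_trans Bc _; rewrite frobenius_normE.
    by apply: ler_sum => i _; rewrite !ffunE.
  apply: le_trans (ler_sum _ (fun c _ => bound c)) _.
  rewrite sumr_const -[leLHS]mulr_natl ler_wpM2r ?expR_ge0 // ler_nat.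
  by rewrite card_sig; exact: max_card.
Qed.

(** * Choice of the constants *)

Lemma ln_nat_ge_half (R : realType) (I : nat) : (1 < I)%N -> 1 / 2 <= ln I%:R :> R.
Proof.
move=> I1; rewrite -[1 / 2]expRK ler_ln ?posrE ?expR_gt0 ?ltr0n ?(ltnW I1) //.
apply: le_trans (expR_half_le ler01 (lexx 1)) _.
by rewrite (_ : 1 + 1 = 2%:R) ?ler_nat.
Qed.

(** Since rho <= I^N, the stability constant (2 rho)^N contributes only
    N (N + 1) log I to the logarithm of Z, whatever the size of r. *)
Lemma code_count_le (R : realType) (N I r : nat) (alpha : R) :
  let rho := minn r (I ^ N) in
  let Z := (alpha + 2) ^+ 2 * (I ^ N)%:R * (2 * rho%:R) ^+ N in
  (0 < N)%N -> (1 < I)%N -> (0 < r)%N -> 0 < alpha ->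
  ((Num.truncn (2 * Z)).+1 ^ (N * I * rho * rho + rho))%:R <=
  expR (2 * (N%:R * I%:R * r%:R ^+ 2) *
        (4 * (alpha + 1) + 3 * N%:R ^+ 2 * ln I%:R)) :> R.
Proof.
move=> rho Z N0 I1 r0 alpha0; set L := ln _.
have I0 : (0 < I)%N by apply: ltnW.
have L0 : 1 / 2 <= L by exact: ln_nat_ge_half.
have rho0 : (0 < rho)%N by rewrite leq_min r0 expn_gt0 I0.
have N1 : 1 <= N%:R :> R by rewrite ler1n.
have IE k : (I ^ k)%:R = expR (k%:R * L) :> R.
  by rewrite natrX expRM_natl lnK // posrE ltr0n.
have rho_le : 2 * rho%:R <= expR (N.+1%:R * L) :> R.
  by rewrite -IE -natrM ler_nat expnS leq_mul // geq_minr.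
have alpha_le : alpha + 2 <= expR (alpha + 1).
  by apply: le_trans (expR_ge1Dx _); lra.
have Z_le : Z <= expR (2 * (alpha + 1) + N%:R * L + N%:R * (N.+1%:R * L)).
  rewrite !expRD expRM_natl [expR (N%:R * (_ * _))]expRM_natl -IE.
  have h2 : 0 <= alpha + 2 by lra.
  have h3 : 0 <= 2 * rho%:R :> R by rewrite mulr_ge0.
  by rewrite !ler_pM ?mulr_ge0 ?exprn_ge0 // lerXn2r // nnegrE expR_ge0.
have Z1 : 1 <= Z.
  rewrite /Z -[leLHS](mulr1 1) ler_pM //.
    rewrite -[leLHS](mulr1 1) ler_pM // ?ler1n ?expn_gt0 ?I0 //.
    by rewrite exprn_ege1 //; lra.
  by rewrite exprn_ege1 // -natrM ler1n muln_gt0.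
have b_le : (Num.truncn (2 * Z)).+1%:R <=
    expR (4 * (alpha + 1) + 3 * N%:R ^+ 2 * L).
  have b_le3 : (Num.truncn (2 * Z)).+1%:R <= 3 * Z.
    have : (Num.truncn (2 * Z))%:R <= 2 * Z by rewrite truncn_le; lra.
    by rewrite -natr1; lra.
  apply: (le_trans b_le3).
  have e3 : 3 <= expR 2 :> R by apply: le_trans (expR_ge1Dx _); lra.
  apply: (@le_trans _ _ (expR 2 * expR (2 * (alpha + 1) + N%:R * L + N%:R * (N.+1%:R * L)))).
    by rewrite ler_pM //; lra.
  rewrite -expRD ler_expR -natr1.
  have : N%:R * L <= N%:R ^+ 2 * L by rewrite ler_wpM2r; [|lra|nra].
  nra.
apply: (@le_trans _ _ (expR (4 * (alpha + 1) + 3 * N%:R ^+ 2 * L)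
    ^+ (2 * (N * I * (r * r))))).
  rewrite natrX.
  have pow_le : (N * I * rho * rho + rho <= 2 * (N * I * (r * r)))%N.
    have rr : (rho <= r)%N by exact: geq_minl.
    rewrite mul2n -addnn leq_add //.
      by rewrite -mulnA leq_mul // leq_mul.
    by rewrite (leq_trans rr) // mulnA leq_pmull // muln_gt0 r0 muln_gt0 N0 I0.
  apply: le_trans (ler_weXn2l _ pow_le) _; first by rewrite ler1n.
  by rewrite lerXn2r ?nnegrE ?expR_ge0.
by rewrite -expRM_natl !natrM ler_expR expr2.
Qed.

(** With A = a + 1 and V = (n + delta)^2 L^2, the quotient is at least
    50 A V W because A / (b + 1) >= 1, while the net contributes at most
    44 A V W, the constant 1 at most 4 A V W and delta L at most A V W; the
    numerical factors come from L >= 1/2. *)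
Lemma exponent_budget (R : realType) (n delta L W a b : R) :
  1 <= n -> 0 < delta -> 1 / 2 <= L -> 1 <= W -> 0 < b -> b <= a ->
  2 * W * (4 * (a + 1) + 3 * n ^+ 2 * L) + (1 -
    (400 * (a + 1) ^+ 4 * (n + delta) ^+ 2 * L ^+ 2 * W / (b + 1) ^+ 2)
      / (8 * (a + 1))) <= - (delta * L).
Proof.
move=> n1 d0 L1 W1 b0 ba.
set V := (n + delta) ^+ 2 * L ^+ 2.
have VnL : n ^+ 2 * L ^+ 2 <= V by rewrite ler_wpM2r ?sqr_ge0 // lerXn2r ?nnegrE; lra.
have n2 : 1 <= n ^+ 2 by rewrite exprn_ege1.
have n2L : n ^+ 2 * L <= 2 * V.
  apply: le_trans (_ : 2 * (n ^+ 2 * L ^+ 2) <= _); last by rewrite ler_wpM2l.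
  have -> : 2 * (n ^+ 2 * L ^+ 2) = (n ^+ 2 * L) * (2 * L) by ring.
  by rewrite ler_peMr; [|nra|lra].
have V4 : 1 <= 4 * V by nra.
have Vd : delta * L <= V.
  have h : 2 * delta <= (n + delta) ^+ 2 by nra.
  have : 2 * delta * L ^+ 2 <= V by rewrite ler_wpM2r ?sqr_ge0.
  nra.
set A := a + 1; have A1 : 1 <= A by rewrite /A; lra.
have quot : 50 * (A * V * W) <=
    (400 * A ^+ 4 * (n + delta) ^+ 2 * L ^+ 2 * W / (b + 1) ^+ 2) / (8 * A).
  have -> : (400 * A ^+ 4 * (n + delta) ^+ 2 * L ^+ 2 * W / (b + 1) ^+ 2) / (8 * A)
      = 50 * (A * V * W) * (A ^+ 2 / (b + 1) ^+ 2).
    by rewrite /V; field; rewrite !gt_eqF //; lra.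
  have AVW0 : 0 <= A * V * W by rewrite !mulr_ge0 //; lra.
  rewrite ler_peMr //; first lra.
  rewrite ler_pdivlMr ?mul1r; last by rewrite exprn_gt0 //; lra.
  by rewrite lerXn2r ?nnegrE /A; lra.
have AV : V <= A * V by rewrite ler_peMl //; lra.
have AVW : A * V <= A * V * W by rewrite ler_peMr //; lra.
have Lb : 4 * A + 3 * n ^+ 2 * L <= 22 * (A * V).
  have : A <= 4 * (A * V) by rewrite mulrCA ler_peMr //; lra.
  lra.
have WLb : 2 * W * (4 * A + 3 * n ^+ 2 * L) <= 44 * (A * V * W).
  have -> : 44 * (A * V * W) = 2 * W * (22 * (A * V)) by ring.
  by rewrite ler_wpM2l //; lra.
lra.
Qed.

Theorem theorem4 (R : realType) :
  exists C1 C2 : R, [/\ 0 < C1, 0 < C2 &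
    forall (N I r : nat) (beta alpha : R) (M : tensor R N I)
      (d : measure_display) (Omega : measurableType d) (P : probability Omega R)
      (X : multi_index N I -> {RV P >-> nat}) (delta : R),
    (0 < N)%N -> (0 < I)%N -> (0 < r)%N ->
    0 < beta ->
    search_space r beta alpha M ->
    poisson_tensor M X ->
    0 < delta ->
    ((1 - I%:R `^ (- delta) - expR (- (C1 * N%:R * I%:R * ln N%:R)))%:E <
     P [set omega | forall Mtilde : tensor R N I,
          is_argmax (search_space r beta alpha)
            (objective (sample X omega)) Mtilde ->
          (frobenius_norm (Mtilde - M) ^+ 2 <=
          C2 * (alpha + 1) ^+ 4 * (N%:R + delta) ^+ 2 * ln I%:R ^+ 2
            * N%:R * I%:R * r%:R ^+ 2 / (beta + 1) ^+ 2)%R])%E].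
Proof.
exists 1, 400; split => // N I r beta alpha M d Omega P X delta N0 I0 r0 beta0 SM XM delta0.
set B := 400 * _ * _ * _ * _ * _ * _ / _; set good := [set omega | _].
have E0 := expR_gt0 (- (1 * N%:R * I%:R * ln N%:R) : R).
have [I1|I1] := leqP I 1.
  have IE : I = 1%N by apply/eqP; rewrite eqn_leq I1 I0.
  apply: lt_le_trans (measure_ge0 P good); rewrite lte_fin.
  have -> : (I%:R : R) `^ (- delta) = 1 by rewrite IE powR1.
  lra.
have beta_alpha : beta <= alpha.
  have [_ /(_ [ffun=> Ordinal I0]) /andP[h1 h2]] := SM.
  exact: le_trans h1 h2.
have alpha0 : 0 < alpha by apply: lt_le_trans beta_alpha.
set rho := minn r (I ^ N).
pose Z : R := (alpha + 2) ^+ 2 * (I ^ N)%:R * (2 * rho%:R) ^+ N.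
(* The admissible displacement makes I^N e (alpha + 2) equal to 1, and Z is
   chosen so that the quantizer achieves it. *)
pose e : R := ((I ^ N)%:R * (alpha + 2))^-1.
have IN1 : 1 <= (I ^ N)%:R :> R by rewrite ler1n expn_gt0 I0.
have rho0 : (0 < rho)%N by rewrite leq_min r0 expn_gt0 I0.
have rhoN0 : 0 < (2 * rho%:R) ^+ N :> R by rewrite exprn_gt0 // mulr_gt0 // ltr0n.
have Z0 : 0 < Z by rewrite !mulr_gt0 // ?exprn_gt0 //; lra.
have e0 : 0 <= e by rewrite invr_ge0 mulr_ge0 //; lra.
have e1 : e <= 1 by rewrite invf_le1; nra.
have [F [q [cardF qP]]] := @low_rank_quantizer R N I r beta alpha Z r0 I0 beta0 beta_alpha Z0.
have mesh : (2 * rho%:R) ^+ N * (alpha / Z) <= e.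
  have -> : (2 * rho%:R) ^+ N * (alpha / Z) = e * (alpha / (alpha + 2)).
    by rewrite /Z /e; field; rewrite !gt_eqF //; lra.
  by rewrite ler_piMr // ler_pdivrMr; lra.
have tail := argmax_error_tail B beta0 SM XM e0 e1
  (fun T T' ST ST' qTT' i => le_trans (qP T T' ST ST' qTT' i) mesh) alpha0.
have bad_le : (P (~` good) <= (I%:R `^ (- delta))%:E)%E.
  have -> : ~` good = [set omega | exists2 T, is_argmax (search_space r beta alpha)
      (objective (sample X omega)) T & B < frobenius_norm (T - M) ^+ 2].
    apply/seteqP; split => omega /=.
      by move=> /existsNP[T /not_implyP[Tmax /negP]]; rewrite -ltNge; exists T.
    by move=> [T Tmax TB] /(_ T Tmax); rewrite leNgt TB.
  apply: (le_trans tail); rewrite lee_fin.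
  have -> : (I ^ N)%:R * (e * (alpha + 2)) = 1.
    by rewrite /e; field; rewrite !gt_eqF //; lra.
  have -> : I%:R `^ (- delta) = expR (- (delta * ln I%:R)) :> R.
    by rewrite /powR gt_eqF ?ltr0n // mulNr.
  rewrite cardF.
  apply: le_trans (ler_wpM2r (expR_ge0 _) (code_count_le N0 I1 r0 alpha0)) _.
  rewrite -expRD ler_expR.
  have W1 : 1 <= N%:R * I%:R * r%:R ^+ 2 :> R.
    by rewrite -natrX -!natrM ler1n !muln_gt0 N0 I0 r0.
  apply: le_trans (exponent_budget _ delta0 (ln_nat_ge_half R I1) W1 beta0 beta_alpha).
    by rewrite /B !mulrA.
  by rewrite ler1n.
have mgood : measurable good.
  exact: (measurable_discrete_sample X [set x | forall T,
    is_argmax (search_space r beta alpha) (objective x) T ->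
    frobenius_norm (T - M) ^+ 2 <= B]).
have -> : P good = (1 - P (~` good))%E.
  by rewrite -[in LHS](setCK good) probability_setC //; exact: measurableC.
apply: lt_le_trans (leeB (lexx 1%E) bad_le).
by rewrite -EFinB lte_fin; lra.
Qed.
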